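(* Let $H=\{h_1,\dots,h_p\}$ be the monomial Pommaret basis of the quasi-stable ideal $I\subseteq P=\Bbbk[x_1,\dots,x_n]$. Then the product $\times$ makes the complex $(C_*,\delta)$ a differential algebra: $\delta\circ\delta=0$, the product $\times$ is associative, and the graded Leibniz rule $$\delta(a\times b)=a\times\delta(b)+(-1)^{|b|}\,\delta(a)\times b$$ holds for all homogeneous $a,b\in C_*$, where $|b|$ denotes the form degree of $b$ (i.e. $|b|=i$ for $b\in C_i$).
   Context: $\Bbbk$ is a field. The class of $\mu\in\mathbb{N}_0^n$ is $\mathrm{cls}\,\mu=\min\{i\mid\mu_i\ne0\}$, $\mathrm{cls}\,0=n$, and $\mathrm{cls}\,x^\mu=\mathrm{cls}\,\mu$; the Pommaret cone of a monomial $x^\mu$ is $\{x^{\mu+\rho}\mid\rho_j=0\ \forall j>\mathrm{cls}\,\mu\}$. A monomial ideal is quasi-stable if there is a finite set $H$ of monomials (its monomial Pommaret basis, which is unique) whose Pommaret cones disjointly decompose the set of monomials of the ideal. For all $\alpha,\beta,k$: $\Delta(\alpha,k)$ and the term $t_{\alpha,k}$ are defined by $x_kh_\alpha=t_{\alpha,k}h_{\Delta(\alpha,k)}$, where $h_{\Delta(\alpha,k)}\in H$ is the unique generator whose Pommaret cone contains $x_kh_\alpha$; $\Gamma(\alpha,\beta)$ and the term $m_{\alpha,\beta}$ are defined by $h_\alpha h_\beta=m_{\alpha,\beta}h_{\Gamma(\alpha,\beta)}$, where $h_{\Gamma(\alpha,\beta)}\in H$ is the unique generator whose Pommaret cone contains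 $h_\alpha h_\beta$. Let $W$ be the free $P$-module with basis $w_1,\dots,w_p$, $V$ the free $P$-module with basis $v_1,\dots,v_n$, $C_i=W\otimes_P\Lambda^iV$ and $C_*=\bigoplus_{i=0}^nC_i$. For $\mathbf{k}=(k_1,\dots,k_i)$ with $1\le k_1<\dots<k_i\le n$ put $v_{\mathbf{k}}=v_{k_1}\wedge\dots\wedge v_{k_i}$, and let $\mathbf{k}_j$ be $\mathbf{k}$ with $k_j$ removed. The $P$-linear differential $\delta:C_i\to C_{i-1}$ is $$\delta(w_\alpha\otimes v_{\mathbf{k}})=\sum_{j=1}^i(-1)^{i-j}\bigl(x_{k_j}w_\alpha-t_{\alpha,k_j}w_{\Delta(\alpha,k_j)}\bigr)\otimes v_{\mathbf{k}_j}$$ (and $\delta=0$ on $C_0$). The product is the $P$-bilinear extension of $w_\alpha\times w_\beta=m_{\alpha,\beta}w_{\Gamma(\alpha,\beta)}$ and $(w\otimes\omega)\times(\bar w\otimes\bar\omega)=(w\times\bar w)\otimes(\omega\wedge\bar\omega)$ for $w,\bar w\in W$, $\omega,\bar\omega\in\Lambda V$. A unit element is not required. *)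

(* Defs.v *)
From mathcomp Require Import all_boot all_order all_algebra.
From mathcomp.multinomials Require Export mpoly.

Set Implicit Arguments.
Unset Strict Implicit.
Unset Printing Implicit Defensive.

Import GRing.Theory.
Local Open Scope ring_scope.

(* Exponent vectors are multinomials 'X_{1..n}.  The variable x_i of the       *)
(* 1-based mathematical notation is 'X_j for the j : 'I_n with j.+1 = i;       *)
(* classes keep their 1-based values.                                         *)

Section Monomials.
Variable n : nat.
Implicit Types mu m : 'X_{1..n}.

(* min {i | mu_i <> 0}, and n for mu = 0 (all indices are at most n). *)
Definition cls mu : nat := \big[minn/n]_(j < n | mu j != 0%N) j.+1.

Definition pommaret_cone mu m : bool :=
  (mu <= m)%MM && [forall j : 'I_n, (cls mu < j.+1)%N ==> ((m - mu)%MM j == 0%N)].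

Lemma pommaret_coneP mu m :
  reflect (exists2 rho : 'X_{1..n}, m = (mu + rho)%MM
             & forall j : 'I_n, (cls mu < j.+1)%N -> rho j = 0%N)
          (pommaret_cone mu m).
Proof.
apply: (iffP andP) => [[le_m /forallP Hm]|[rho -> Hrho]].
  exists (m - mu)%MM; first by rewrite addmC submK.
  by move=> j Hj; apply/eqP; move/implyP: (Hm j); apply.
split; first exact: lem_addr.
by apply/forallP => j; apply/implyP => Hj; rewrite addmC addmK Hrho.
Qed.

End Monomials.

Section Ideals.
Variables (K : fieldType) (n : nat).
Local Notation P := {mpoly K[n]}.
Implicit Types I J : P -> Prop.

(* The library's idealr_closed excludes the unit ideal, which is allowed here. *)
Definition is_ideal I : Prop :=
  [/\ I 0, forall f g, I f -> I g -> I (f + g) & forall f g, I g -> I (f * g)].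

Definition monomial_ideal I : Prop :=
  is_ideal I /\
  exists M : 'X_{1..n} -> Prop, forall f, I f <->
    forall J, is_ideal J -> (forall m, M m -> J 'X_[m]) -> J f.

(* Disjointness of the cones forces the h_alpha to be pairwise distinct. *)
Definition is_pommaret_basis I p (h : 'I_p -> 'X_{1..n}) : Prop :=
  (forall m, I 'X_[m] <-> exists a, pommaret_cone (h a) m) /\
  (forall a b m, pommaret_cone (h a) m -> pommaret_cone (h b) m -> a = b).

Definition quasi_stable I : Prop :=
  monomial_ideal I /\ exists p (h : 'I_p -> 'X_{1..n}), is_pommaret_basis I h.

End Ideals.

Section Generators.
Variables (n p : nat) (h : 'I_p -> 'X_{1..n}).
Implicit Types (a b : 'I_p) (k : 'I_n).

(* Index of the generator whose cone contains m; the value a is only a default *)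
(* that is never used when m lies in some cone, see cone_genP.                *)
Definition cone_gen a (m : 'X_{1..n}) : 'I_p :=
  odflt a [pick b | pommaret_cone (h b) m].

Definition Delta a k : 'I_p := cone_gen a (U_(k) + h a)%MM.
Definition Delta_term a k : 'X_{1..n} := (U_(k) + h a - h (Delta a k))%MM.

Definition Gamma a b : 'I_p := cone_gen a (h a + h b)%MM.
Definition Gamma_term a b : 'X_{1..n} := (h a + h b - h (Gamma a b))%MM.

End Generators.

Section ConeGenSpec.
Variables (K : fieldType) (n p : nat) (I : {mpoly K[n]} -> Prop).
Variable h : 'I_p -> 'X_{1..n}.
Hypotheses (idI : is_ideal I) (basis_h : is_pommaret_basis I h).

Lemma basis_in_ideal a : I 'X_[h a].
Proof.
apply/basis_h.1; exists a; apply/pommaret_coneP; exists 0%MM => [|j _].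
  by rewrite addm0.
exact: mnmE.
Qed.

Lemma cone_genP a u b c :
  pommaret_cone (h c) (u + h b) <-> c = cone_gen h a (u + h b).
Proof.
have [d Hd] : exists d, pommaret_cone (h d) (u + h b).
  apply/basis_h.1; rewrite mpolyXD.
  by case: idI => _ _; apply; exact: basis_in_ideal.
have -> : cone_gen h a (u + h b) = d.
  rewrite /cone_gen; case: pickP => [d' Hd'|/(_ d)]; last by rewrite Hd.
  exact: basis_h.2 Hd' Hd.
by split=> [Hc|-> //]; apply: basis_h.2 Hc Hd.
Qed.

Lemma DeltaP a k :
  (U_(k) + h a = Delta_term h a k + h (Delta h a k))%MM
  /\ (forall c, pommaret_cone (h c) (U_(k) + h a) <-> c = Delta h a k).
Proof.
have H := cone_genP a U_(k) a; split=> //.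
by rewrite submK //; have /andP[] := (H (Delta h a k)).2 erefl.
Qed.

Lemma GammaP a b :
  (h a + h b = Gamma_term h a b + h (Gamma h a b))%MM
  /\ (forall c, pommaret_cone (h c) (h a + h b) <-> c = Gamma h a b).
Proof.
have H := cone_genP a (h a) b; split=> //.
by rewrite submK //; have /andP[] := (H (Gamma h a b)).2 erefl.
Qed.

End ConeGenSpec.

(* Free P-modules are finite functions from the basis to P^o: W has basis      *)
(* 'I_p, the exterior algebra of V has basis {set 'I_n} (the set S stands for  *)
(* v_S, the wedge of the v_k, k in S, in increasing order), and C_* = W (x) /\V *)
(* has basis 'I_p * {set 'I_n}.                                               *)
Section Complex.
Variables (K : fieldType) (n p : nat) (h : 'I_p -> 'X_{1..n}).
Local Notation P := {mpoly K[n]}.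

Definition freeW := {ffun 'I_p -> P^o}.
Definition extV := {ffun {set 'I_n} -> P^o}.
Definition complexC := {ffun 'I_p * {set 'I_n} -> P^o}.

Implicit Types (S T : {set 'I_n}) (c d : complexC).

Definition w_ (a : 'I_p) : freeW := [ffun b => (b == a)%:R].
Definition v_ S : extV := [ffun T => (T == S)%:R].

Definition tensor (w : freeW) (l : extV) : complexC :=
  [ffun x => w x.1 * l x.2].

Definition form_degree (i : nat) c : Prop := forall x, c x != 0 -> #|x.2| = i.

(* The sorting permutation of the concatenation of S and T has this length. *)
Definition inversions S T : nat :=
  #|[set x : 'I_n * 'I_n | [&& x.1 \in S, x.2 \in T & (x.2 < x.1)%N]]|.

Definition wedge_basis S T : extV :=
  if [disjoint S & T] then (-1 : P) ^+ inversions S T *: v_ (S :|: T) else 0.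

Definition wedge (l l' : extV) : extV :=
  \sum_S \sum_T (l S * l' T : P) *: wedge_basis S T.

Definition wprod (w w' : freeW) : freeW :=
  \sum_a \sum_b (w a * w' b : P) *:
    (('X_[Gamma_term h a b] : P) *: w_ (Gamma h a b)).

Definition cprod c d : complexC :=
  \sum_x \sum_y (c x * d y : P) *:
    tensor (wprod (w_ x.1) (w_ y.1)) (wedge (v_ x.2) (v_ y.2)).

(* enum_val lists S in increasing order, so that for S = {k_1 < ... < k_i} the *)
(* summand with 0-based index j is the one of k_(j.+1).                       *)
Definition delta_basis (a : 'I_p) S : complexC :=
  \sum_(j < #|S|)
     let k : 'I_n := enum_val j in
     (-1 : P) ^+ (#|S| - j.+1) *:
       tensor (('X_k : P) *: w_ a
               - ('X_[Delta_term h a k] : P) *: w_ (Delta h a k))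
              (v_ (S :\ k)).

Definition delta c : complexC := \sum_x (c x : P) *: delta_basis x.1 x.2.

Lemma w_E (a b : 'I_p) : w_ a b = (b == a)%:R. Proof. exact: ffunE. Qed.
Lemma v_E S T : v_ S T = (T == S)%:R. Proof. exact: ffunE. Qed.

Lemma tensor_basis (a : 'I_p) S x :
  tensor (w_ a) (v_ S) x = (x == (a, S))%:R.
Proof.
by rewrite !ffunE -natrM mulnb.
Qed.

Lemma delta_is_linear : linear delta.
Proof.
move=> r c d; rewrite /delta scaler_sumr -big_split; apply: eq_bigr => x _ /=.
by rewrite scalerA -scalerDl !ffunE.
Qed.

Lemma delta_tensor a S : delta (tensor (w_ a) (v_ S)) = delta_basis a S.
Proof.
rewrite /delta (bigD1 (a, S)) //= tensor_basis eqxx scale1r big1 ?addr0 //.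
by move=> x xP; rewrite tensor_basis (negPf xP) scale0r.
Qed.

Lemma cprod_is_linear_l d : linear (cprod^~ d).
Proof.
move=> r c c'; rewrite /cprod scaler_sumr -big_split; apply: eq_bigr => x _ /=.
rewrite scaler_sumr -big_split; apply: eq_bigr => y _ /=.
by rewrite scalerA -scalerDl !ffunE mulrA mulrDl.
Qed.

Lemma cprod_is_linear_r c : linear (cprod c).
Proof.
move=> r d d'; rewrite /cprod scaler_sumr -big_split; apply: eq_bigr => x _ /=.
rewrite scaler_sumr -big_split; apply: eq_bigr => y _ /=.
rewrite scalerA -scalerDl !ffunE; congr (_ *: _).
by rewrite mulrDr mulrCA.
Qed.

Lemma freeW_expand (w : freeW) : w = \sum_a (w a : P) *: w_ a.
Proof.
apply/ffunP=> b; rewrite sum_ffunE (bigD1 b) //= big1 ?addr0.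
  by rewrite !ffunE eqxx [_ *: _]mulr1.
by move=> a /negPf ab; rewrite !ffunE eq_sym ab scaler0.
Qed.

Lemma extV_expand (l : extV) : l = \sum_S (l S : P) *: v_ S.
Proof.
apply/ffunP=> T; rewrite sum_ffunE (bigD1 T) //= big1 ?addr0.
  by rewrite !ffunE eqxx [_ *: _]mulr1.
by move=> S /negPf TS; rewrite !ffunE eq_sym TS scaler0.
Qed.

Lemma sum_basis (A : finType) (M : lmodType P) (u : A) (F : A -> M) :
  \sum_x ((x == u)%:R : P) *: F x = F u.
Proof.
rewrite (bigD1 u) //= eqxx scale1r big1 ?addr0 // => x /negPf ->.
exact: scale0r.
Qed.

Lemma wprod_basis a b :
  wprod (w_ a) (w_ b) = ('X_[Gamma_term h a b] : P) *: w_ (Gamma h a b).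
Proof.
rewrite -(sum_basis a (fun a' => 'X_[Gamma_term h a' b] *: w_ (Gamma h a' b))).
apply: eq_bigr => a' _.
rewrite -(sum_basis b (fun b' => 'X_[Gamma_term h a' b'] *: w_ (Gamma h a' b'))).
rewrite scaler_sumr; apply: eq_bigr => b' _.
by rewrite !w_E -scalerA.
Qed.

Lemma wedge_vE S T : wedge (v_ S) (v_ T) = wedge_basis S T.
Proof.
rewrite -(sum_basis S (wedge_basis^~ T)); apply: eq_bigr => S' _.
rewrite -(sum_basis T (wedge_basis S')) scaler_sumr; apply: eq_bigr => T' _.
by rewrite !v_E -scalerA.
Qed.

Lemma cprod_tensor (w w' : freeW) (l l' : extV) :
  cprod (tensor w l) (tensor w' l') = tensor (wprod w w') (wedge l l').
Proof.
have mulE (A B C D E F : P) : (A * B * (C * D)) * (E * F) = (A * C * E) * (B * D * F).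
  by rewrite (mulrACA A) (mulrACA (A * C)).
apply/ffunP=> z; rewrite /cprod !ffunE !sum_ffunE.
under [in RHS]eq_bigr do rewrite sum_ffunE.
under [X in _ * X]eq_bigr do rewrite sum_ffunE.
rewrite (eq_bigr (fun x => \sum_y
    ((w x.1 * w' y.1) * wprod (w_ x.1) (w_ y.1) z.1)
     * ((l x.2 * l' y.2) * wedge (v_ x.2) (v_ y.2) z.2))); last first.
  move=> x _; rewrite sum_ffunE; apply: eq_bigr => y _.
  by rewrite !ffunE; exact: mulE.
rewrite -(pair_bigA _ (fun a S => \sum_y
    ((w a * w' y.1) * wprod (w_ a) (w_ y.1) z.1)
     * ((l S * l' y.2) * wedge (v_ S) (v_ y.2) z.2))) /=.
rewrite big_distrl /=; apply: eq_bigr => a _.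
rewrite big_distrr /=; apply: eq_bigr => S _.
rewrite -(pair_bigA _ (fun b T =>
    ((w a * w' b) * wprod (w_ a) (w_ b) z.1)
     * ((l S * l' T) * wedge (v_ S) (v_ T) z.2))) /=.
rewrite big_distrl /=; apply: eq_bigr => b _.
rewrite big_distrr /=; apply: eq_bigr => T _.
by congr (_ * _); symmetry; [rewrite -wprod_basis | rewrite -wedge_vE];
   exact: ffunE.
Qed.

Lemma form_degree_tensor_v (w : freeW) S : form_degree #|S| (tensor w (v_ S)).
Proof.
move=> x; rewrite !ffunE; have [-> // | _] := eqVneq x.2 S.
by rewrite mulr0 eqxx.
Qed.

Lemma form_degree_sum (A : finType) (F : A -> complexC) i :
  (forall x, form_degree i (F x)) -> form_degree i (\sum_x F x).
Proof.
move=> HF x; rewrite sum_ffunE => nz; apply/eqP; apply: contraNT nz => xi.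
rewrite big1 // => y _; apply/eqP; apply: contraNT xi => Fx.
by apply/eqP; exact: HF Fx.
Qed.

Lemma form_degreeZ (r : P) c i : form_degree i c -> form_degree i (r *: c).
Proof.
move=> Hc x; rewrite ffunE => rc0; apply: Hc.
by apply: contraNneq rc0 => ->; rewrite scaler0.
Qed.

Lemma form_degree_delta c i : form_degree i c -> form_degree i.-1 (delta c).
Proof.
move=> Hc; apply: form_degree_sum => x.
have [-> | cx0] := eqVneq (c x) 0; first by move=> y; rewrite scale0r ffunE eqxx.
apply: form_degreeZ; rewrite -(Hc _ cx0); apply: form_degree_sum => j.
apply: form_degreeZ; rewrite [#|x.2|](cardsD1 (enum_val j)) enum_valP.
exact: form_degree_tensor_v.
Qed.

Lemma form_degree_cprod c d i j :
  form_degree i c -> form_degree j d -> form_degree (i + j) (cprod c d).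
Proof.
move=> Hc Hd; apply: form_degree_sum => x; apply: form_degree_sum => y.
have [-> | cx0] := eqVneq (c x) 0.
  by move=> z; rewrite mul0r scale0r ffunE eqxx.
have [-> | dy0] := eqVneq (d y) 0.
  by move=> z; rewrite mulr0 scale0r ffunE eqxx.
apply: form_degreeZ; rewrite wedge_vE /wedge_basis -(Hc _ cx0) -(Hd _ dy0).
case: ifP => [ST | _]; last by move=> z; rewrite !ffunE mulr0 eqxx.
have -> : (#|x.2| + #|y.2|)%N = #|x.2 :|: y.2|.
  by rewrite cardsU disjoint_setI0 // cards0 subn0.
set w := wprod _ _; set r := (-1) ^+ _.
have -> : tensor w (r *: v_ (x.2 :|: y.2)) = r *: tensor w (v_ (x.2 :|: y.2)).
  by apply/ffunP => z; rewrite ffunE [RHS]ffunE [in RHS]ffunE [in LHS]ffunE; exact: mulrCA.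
by apply: form_degreeZ; exact: form_degree_tensor_v.
Qed.

End Complex.
Arguments delta_basis {K n p} h a S.
Arguments w_ {K n p} a.
Arguments v_ {K n} S.

(* Main.v *)
(** Let e(u) = m w_a for a monomial u = m h_a in the Pommaret cone of h_a.  The
    class of the generator whose cone contains u does not decrease when u is
    multiplied by a monomial, so u lies in the cone of h_a only if s u and s h_a
    lie in the same cone.  Hence the P-linear maps sigma_s : w_a |-> e(s h_a)
    satisfy sigma_s (e u) = e(s u) and commute with each other.  Multiplication
    by w_a is sigma_{h_a}, and the coefficient operators A_k = x_k - sigma_{x_k}
    of the differential commute with it and with one another.  As
    delta(w (x) l) is the sum over k of A_k w (x) (l contracted by v_k) and
    contractions anticommute and are antiderivations, everything follows. *)

Require Import Defs.
From HB Require Import structures.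
From mathcomp Require Import all_boot all_order all_algebra.
From mathcomp Require Import zify.

Set Implicit Arguments.
Unset Strict Implicit.
Unset Printing Implicit Defensive.

Import GRing.Theory.
Local Open Scope ring_scope.

(** * Classes of monomials and Pommaret cones *)

Section PommaretCones.
Variable n : nat.
Implicit Types mu m s : 'X_{1..n}.

Lemma cls_le mu (j : 'I_n) : mu j != 0%N -> (cls mu <= j.+1)%N.
Proof.
move=> muj; rewrite /cls; have := mem_index_enum j.
elim: (index_enum _) => // i r IH; rewrite inE big_cons => /predU1P [<-|/IH le_r].
  by rewrite muj geq_minl.
by case: ifP => // _; apply: leq_trans le_r; exact: geq_minr.
Qed.

Lemma leq_cls mu k : (k <= n)%N ->
  (forall j : 'I_n, mu j != 0%N -> (k <= j.+1)%N) -> (k <= cls mu)%N.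
Proof.
move=> kn kmu; rewrite /cls.
by elim/big_ind: _ => // x y; rewrite leq_min => -> ->.
Qed.

Lemma cls_leqn mu : (cls mu <= n)%N.
Proof.
rewrite /cls; elim/big_ind: _ => // x y xn _; exact: leq_trans (geq_minl _ _) xn.
Qed.

Lemma cls_anti mu m : (mu <= m)%MM -> (cls m <= cls mu)%N.
Proof.
move=> /mnm_lepP mum; apply: leq_cls => [|j muj]; first exact: cls_leqn.
by apply: cls_le; apply: contraNneq muj => mj; rewrite -leqn0 -mj.
Qed.

Lemma pommaret_cone_refl mu : pommaret_cone mu mu.
Proof.
apply/pommaret_coneP; exists 0%MM => [|j _]; first by rewrite addm0.
exact: mnmE.
Qed.

Lemma pommaret_cone_le mu m : pommaret_cone mu m -> (mu <= m)%MM.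
Proof. by case/andP. Qed.

(** The quotient of [m] by [mu] involves only variables up to [cls mu], hence up to [cls nu], so it
    can be absorbed into the multiplier of [nu]. *)
Lemma pommaret_cone_add mu nu s m : (cls mu <= cls nu)%N ->
  pommaret_cone mu m -> pommaret_cone nu (s + mu) -> pommaret_cone nu (s + m).
Proof.
move=> le_cls /pommaret_coneP [r -> r0] /pommaret_coneP [r' e r'0].
apply/pommaret_coneP; exists (r' + r)%MM; first by rewrite addmA e addmA.
by move=> j bj; rewrite mnmDE r'0 // r0 //; apply: leq_ltn_trans bj.
Qed.

End PommaretCones.

(** * How the cones of a Pommaret basis behave under multiplication *)

Section PommaretBasis.
Variables (K : fieldType) (n p : nat) (I : {mpoly K[n]} -> Prop).
Variable h : 'I_p -> 'X_{1..n}.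
Hypotheses (idI : is_ideal I) (basis_h : is_pommaret_basis I h).
Implicit Types (s u : 'X_{1..n}) (a b c : 'I_p).

Lemma cone_exists s c u :
  pommaret_cone (h c) u -> exists b, pommaret_cone (h b) (s + u).
Proof.
move=> cu; apply/basis_h.1; rewrite mpolyXD.
by case: idI => _ _; apply; apply/basis_h.1; exists c.
Qed.

(** If $x_k$ is multiplicative for [h a], the product stays in the cone of [h a] and disjointness
    gives [a = b]. Otherwise $k$ lies above the class of [h a], so the product has at least that
    class, and so has its divisor [h b]. *)
Lemma cone_var_cls (k : 'I_n) a b :
  pommaret_cone (h b) (U_(k) + h a) -> (cls (h a) <= cls (h b))%N.
Proof.
move=> bka; have [ka|ak] := leqP k.+1 (cls (h a)).
  suff -> : a = b by [].
  apply: basis_h.2 bka; apply/pommaret_coneP; exists U_(k)%MM; first exact: addmC.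
  move=> j aj; rewrite mnm1E; case: eqP => // kj.
  by move: (leq_ltn_trans ka aj); rewrite kj ltnn.
apply: leq_trans (cls_anti (pommaret_cone_le bka)).
apply: leq_cls => [|j]; first exact: cls_leqn.
rewrite mnmDE mnm1E; case: (eqVneq k j) => [<- _|_]; first exact: ltnW.
exact: cls_le.
Qed.

(* Multiplying by one variable at a time, the class of the generator whose
   cone is reached never decreases. *)
Lemma cone_cls s a b u :
  pommaret_cone (h a) u -> pommaret_cone (h b) (s + u) ->
  (cls (h a) <= cls (h b))%N.
Proof.
move=> au; have [d le_sd] := ubnP (mdeg s).
elim: d s b le_sd => // d IH s b le_sd.
have [s0|] := eqVneq s 0%MM.
  by rewrite s0 add0m => bu; rewrite (basis_h.2 _ _ _ au bu).
rewrite -mdeg_eq0 mdegE sum_nat_eq0 negb_forall => /existsP [k sk].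
have : s = (U_(k) + (s - U_(k)))%MM.
  rewrite addmC submK //; apply/mnm_lepP => j; rewrite mnm1E.
  by case: eqP => // <-; rewrite lt0n.
move: (s - U_(k))%MM => t st; rewrite st mdegD mdeg1 ltnS in le_sd.
rewrite st -addmA => bktu; have [c ctu] := cone_exists t au.
have [e ekc] := cone_exists U_(k) (pommaret_cone_refl (h c)).
(* Since [cls (h c) <= cls (h e)], the product $x_k t u$ lies in the cone of [h e] as well as in
   that of [h b], so [e = b]. *)
rewrite -(basis_h.2 _ _ _ (pommaret_cone_add (cone_var_cls ekc) ctu ekc) bktu).
exact: leq_trans (IH _ _ le_sd ctu) (cone_var_cls ekc).
Qed.

Lemma cone_trans s a b u :
  pommaret_cone (h a) u -> pommaret_cone (h b) (s + h a) ->
  pommaret_cone (h b) (s + u).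
Proof.
by move=> au bsa; exact: pommaret_cone_add (cone_cls (pommaret_cone_refl _) bsa) au bsa.
Qed.

End PommaretBasis.

(** * Linear and bilinear maps on free modules *)

Section FreeModules.
Variables (R : comNzRingType) (X Y : finType) (M : lmodType R).
Local Notation freeX := {ffun X -> R^o}.
Local Notation freeY := {ffun Y -> R^o}.

Lemma lincomb_linear (F : X -> M) :
  linear (fun u : freeX => \sum_x (u x : R) *: F x).
Proof.
move=> r u v; rewrite scaler_sumr -big_split; apply: eq_bigr => x _ /=.
by rewrite scalerA -scalerDl !ffunE.
Qed.

(** Covers [wprod], [wedge] and [cprod] at once: all three are double sums of this shape. *)
Lemma bicomb_bilinear (F : X -> Y -> M) :
  bilinear_for (GRing.Scale.Law.clone _ _ *:%R _) (GRing.Scale.Law.clone _ _ *:%R _)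
    (fun (u : freeX) (v : freeY) => \sum_x \sum_y (u x * v y : R) *: F x y).
Proof.
split=> w r u v /=; rewrite scaler_sumr -big_split; apply: eq_bigr => x _ /=;
  rewrite scaler_sumr -big_split; apply: eq_bigr => y _ /=;
  rewrite scalerA -scalerDl !ffunE.
  by rewrite mulrA mulrDl.
by rewrite mulrDr mulrCA.
Qed.

Definition free_basis (x : X) : freeX := [ffun y => (y == x)%:R].

(** Restricting to the support of [u] serves the Leibniz rule, whose sign is tied to the form
    degree, and [form_degree] constrains only the support. *)
Lemma linear_ext_supp (f g : freeX -> M) (u : freeX) : linear f -> linear g ->
  (forall x, u x != 0 -> f (free_basis x) = g (free_basis x)) -> f u = g u.
Proof.
move=> lin_f lin_g fg.
pose F : {linear freeX -> M} := HB.pack f (GRing.isLinear.Build _ _ _ _ f lin_f).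
pose G : {linear freeX -> M} := HB.pack g (GRing.isLinear.Build _ _ _ _ g lin_g).
have -> : u = \sum_x (u x : R) *: free_basis x.
  apply/ffunP=> y; rewrite sum_ffunE (bigD1 y) //= big1 ?addr0.
    by rewrite !ffunE eqxx [_ *: _]mulr1.
  by move=> x /negPf xy; rewrite !ffunE eq_sym xy scaler0.
rewrite -[LHS]/(F _) -[RHS]/(G _) !linear_sum; apply: eq_bigr => x _.
rewrite !linearZ /=; have [->|ux] := eqVneq (u x) 0; first by rewrite !scale0r.
by rewrite fg.
Qed.

Lemma linear_ext (f g : freeX -> M) : linear f -> linear g ->
  (forall x, f (free_basis x) = g (free_basis x)) -> f =1 g.
Proof. by move=> lin_f lin_g fg u; apply: linear_ext_supp. Qed.

End FreeModules.

(** * The module $W$: shifts, product and coefficient operators *)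

Section FreeModuleW.
Variables (K : fieldType) (n p : nat) (h : 'I_p -> 'X_{1..n}).
Local Notation P := {mpoly K[n]}.
Local Notation W := (freeW K n p).
Implicit Types (s t u : 'X_{1..n}) (a b c : 'I_p) (w : W).

HB.instance Definition _ := bilinear_isBilinear.Build P W W W _ _ (@wprod K n p h)
  (bicomb_bilinear _).

(* The value outside the ideal is junk. *)
Definition normal_form u : W :=
  if [pick b | pommaret_cone (h b) u] is Some b
  then ('X_[u - h b] : P) *: w_ b else 0.

(** The map $\sigma_s$, with [normal_form] in the role of $e$. *)
Definition shift s (w : W) : W := \sum_a (w a : P) *: normal_form (s + h a).

HB.instance Definition _ s := GRing.isLinear.Build P W W _ (shift s)
  (lincomb_linear _).

(** The coefficient operator $A_k$ of the differential. *)
Definition dvar (k : 'I_n) w : W := ('X_k : P) *: w - shift U_(k) w.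

Fact dvar_is_linear k : linear (dvar k).
Proof.
move=> r u v; rewrite /dvar [shift _ _]linearP /= !scalerDr scalerN opprD addrACA.
by rewrite !scalerA mulrC.
Qed.
HB.instance Definition _ k := GRing.isLinear.Build P W W _ (dvar k) (dvar_is_linear k).

Lemma shift_w s a : shift s (w_ a) = normal_form (s + h a).
Proof.
rewrite -[RHS](sum_basis a (fun b => normal_form (s + h b))).
by apply: eq_bigr => b _; rewrite w_E.
Qed.

Variable I : P -> Prop.
Hypotheses (idI : is_ideal I) (basis_h : is_pommaret_basis I h).

Lemma normal_formE u a : pommaret_cone (h a) u ->
  normal_form u = ('X_[u - h a] : P) *: w_ a.
Proof.
rewrite /normal_form => au; case: pickP => [b bu|/(_ a)]; last by rewrite au.
by rewrite (basis_h.2 _ _ _ au bu).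
Qed.

(** By [cone_trans], the generator reached from [s + h a] is also the one for [s + u]; the monomial
    coefficients then multiply up. *)
Lemma shift_normal_form s a u : pommaret_cone (h a) u ->
  shift s (normal_form u) = normal_form (s + u).
Proof.
move=> au; have [b bsa] := cone_exists idI basis_h s (pommaret_cone_refl (h a)).
have bsu := cone_trans idI basis_h au bsa.
rewrite (normal_formE au) linearZ /= shift_w (normal_formE bsa) (normal_formE bsu).
rewrite scalerA -mpolyXD; congr ('X_[_] *: _).
have /mnm_lepP le1 := pommaret_cone_le au; have /mnm_lepP le2 := pommaret_cone_le bsa.
apply/mnmP => j; move: (le1 j) (le2 j); rewrite !(mnmBE, mnmDE); lia.
Qed.

Lemma shiftD s t w : shift s (shift t w) = shift (s + t) w.
Proof.
move: w; apply: linear_ext => [r u v|r u v|a]; first by rewrite !linearP.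
  by rewrite linearP.
rewrite -/(w_ a) !shift_w -addmA.
have [b bta] := cone_exists idI basis_h t (pommaret_cone_refl (h a)).
exact: shift_normal_form bta.
Qed.

(** Every [s + h b] lies in some cone, so the default index [c] never matters; this links [Delta]
    and [Gamma] to [normal_form]. *)
Lemma normal_form_gen c s b :
  ('X_[s + h b - h (cone_gen h c (s + h b))] : P) *: w_ (cone_gen h c (s + h b))
  = normal_form (s + h b).
Proof. by rewrite -normal_formE //; apply/(cone_genP idI basis_h). Qed.

Lemma wprodwl a w : wprod h (w_ a) w = shift (h a) w.
Proof.
move: w; apply: linear_ext => [r u v|r u v|b]; first by rewrite linearPr.
  by rewrite linearP.
by rewrite -/(w_ b) wprod_basis shift_w /Gamma_term /Gamma normal_form_gen.
Qed.

Lemma wprodwr a w : wprod h w (w_ a) = shift (h a) w.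
Proof.
move: w; apply: linear_ext => [r u v|r u v|b]; first by rewrite linearPl.
  by rewrite linearP.
by rewrite -/(w_ b) wprod_basis shift_w addmC /Gamma_term /Gamma normal_form_gen.
Qed.

(** Once the two outer factors are basis elements, both sides apply two shifts to the middle factor,
    in opposite orders, and shifts commute. *)
Lemma wprodA : associative (wprod h : W -> W -> W).
Proof.
move=> w w'' w'; move: w; apply: linear_ext => [r u v|r u v|a].
- by rewrite linearPl.
- by rewrite !linearPl.
rewrite -/(w_ a); move: w'; apply: linear_ext => [r u v|r u v|c].
- by rewrite !linearPr.
- by rewrite linearPr.
by rewrite -/(w_ c) !wprodwl !wprodwr !shiftD addmC.
Qed.

Lemma dvarC k l w : dvar k (dvar l w) = dvar l (dvar k w).
Proof.
(* The expanded form is visibly symmetric in [i] and [j]. *)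
have dvar2 i j : dvar i (dvar j w) =
    (('X_i * 'X_j : P) *: w + shift (U_(i) + U_(j)) w)
    - (('X_i : P) *: shift U_(j) w + ('X_j : P) *: shift U_(i) w).
  rewrite /dvar [shift _ (_ - _)]linearB /= [shift _ (_ *: _)]linearZ /= shiftD.
  have BB (x y z t : W) : (x - y) - (z - t) = (x + t) - (y + z).
    by rewrite opprB opprD addrACA.
  by rewrite scalerBr scalerA; exact: BB.
by rewrite !dvar2 mulrC addmC [in RHS](addrC (_ *: shift _ _)).
Qed.

Lemma shift_dvar s k w : shift s (dvar k w) = dvar k (shift s w).
Proof.
by rewrite /dvar [shift _ (_ - _)]linearB /= [shift _ (_ *: _)]linearZ /= !shiftD addmC.
Qed.

(** Multiplication by a basis element is a shift, and shifts commute with $A_k$. *)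
Lemma dvar_wprodr k w w' : dvar k (wprod h w w') = wprod h w (dvar k w').
Proof.
move: w; apply: linear_ext => [r u v|r u v|a]; first by rewrite linearPl linearP.
  by rewrite linearPl.
by rewrite -/(w_ a) !wprodwl shift_dvar.
Qed.

Lemma dvar_wprodl k w w' : dvar k (wprod h w w') = wprod h (dvar k w) w'.
Proof.
move: w'; apply: linear_ext => [r u v|r u v|a]; first by rewrite linearPr linearP.
  by rewrite linearPr.
by rewrite -/(w_ a) !wprodwr shift_dvar.
Qed.

Lemma dvar_w k a : dvar k (w_ a) =
  ('X_k : P) *: w_ a - ('X_[Delta_term h a k] : P) *: w_ (Delta h a k).
Proof. by rewrite /dvar shift_w -(normal_form_gen a). Qed.

End FreeModuleW.

(** * The exterior algebra: inversion signs, wedge and contractions *)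

Section ExteriorAlgebra.
Variables (K : fieldType) (n : nat).
Local Notation P := {mpoly K[n]}.
Local Notation L := (extV K n).
Implicit Types (S T U : {set 'I_n}) (k : 'I_n) (l : L).

HB.instance Definition _ := bilinear_isBilinear.Build P L L L _ _ (@wedge K n)
  (bicomb_bilinear _).

Lemma eq_signr (A : pzRingType) (i j : nat) :
  odd i = odd j -> (-1) ^+ i = (-1) ^+ j :> A.
Proof. by move=> ij; rewrite -signr_odd ij signr_odd. Qed.

Lemma inversionsE S T : inversions S T = (\sum_(i in S) \sum_(j in T) (j < i))%N.
Proof.
rewrite /inversions -sum1_card pair_big /= big_mkcond [RHS]big_mkcond /=.
apply: eq_bigr => -[i j] _; rewrite inE /=.
by case: (i \in S); case: (j \in T); case: (j < i)%N.
Qed.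

Lemma inversionsUl S T U : [disjoint S & T] ->
  inversions (S :|: T) U = (inversions S U + inversions T U)%N.
Proof.
move=> dST; rewrite !inversionsE -bigU //=.
by apply: eq_bigl => i; rewrite !inE.
Qed.

Lemma inversionsUr S T U : [disjoint T & U] ->
  inversions S (T :|: U) = (inversions S T + inversions S U)%N.
Proof.
move=> dTU; rewrite !inversionsE -big_split; apply: eq_bigr => i _ /=.
by rewrite -bigU //=; apply: eq_bigl => j; rewrite !inE.
Qed.

Lemma inversionsD1l S T k : k \in S ->
  inversions S T = (inversions [set k] T + inversions (S :\ k) T)%N.
Proof.
by move=> kS; rewrite -inversionsUl ?setD1K // disjoints1 !inE eqxx.
Qed.

Lemma inversionsD1r S T k : k \in T ->
  inversions S T = (inversions S [set k] + inversions S (T :\ k))%N.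
Proof.
by move=> kT; rewrite -inversionsUr ?setD1K // disjoints1 !inE eqxx.
Qed.

(** Each element of [T] other than [k] forms an inversion with [k] in exactly one of the two
    orders. *)
Lemma inversions1C T k :
  (inversions [set k] T + inversions T [set k])%N = #|T :\ k|.
Proof.
rewrite !inversionsE big_set1 -big_split -sum1_card /=.
rewrite [LHS]big_mkcond [RHS]big_mkcond /=.
apply: eq_bigr => j _; rewrite !inE; case: (j \in T); rewrite ?andbF //= andbT big_set1.
by rewrite -(inj_eq val_inj) /=; case: ltngtP.
Qed.

(** Both sides vanish unless the sets are pairwise disjoint; then both exponents are the sum of the
    inversions of the three pairs. *)
Lemma wedge_vA S T U :
  wedge (wedge (v_ S) (v_ T)) (v_ U) = wedge (v_ S) (wedge (v_ T) (v_ U)) :> L.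
Proof.
rewrite !wedge_vE /wedge_basis.
case: (boolP [disjoint S & T]) => dST; last first.
  rewrite linear0l.
  case: (boolP [disjoint T & U]) => dTU; last by rewrite linear0r.
  rewrite linearZr_LR /= wedge_vE /wedge_basis ifN ?scaler0 //.
  by apply: contra dST; apply: disjointWr; exact: subsetUl.
case: (boolP [disjoint T & U]) => dTU; last first.
  rewrite linear0r linearZl_LR /= wedge_vE /wedge_basis ifN ?scaler0 //.
  by apply: contra dTU; apply: disjointWl; exact: subsetUr.
rewrite linearZl_LR linearZr_LR /= !wedge_vE /wedge_basis.
have -> : [disjoint S :|: T & U] = [disjoint S & U].
  by rewrite -!setI_eq0 setIUl setU_eq0 (setI_eq0 T) dTU andbT.
have -> : [disjoint S & T :|: U] = [disjoint S & U].
  by rewrite -!setI_eq0 setIUr setU_eq0 (setI_eq0 S T) dST.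
case: (boolP [disjoint S & U]) => dSU; last by rewrite 2!scaler0.
rewrite !scalerA -!exprD (inversionsUl U dST) (inversionsUr S dTU) setUA.
by congr (_ ^+ _ *: _); rewrite addnA addnC.
Qed.

Lemma wedgeA : associative (@wedge K n).
Proof.
move=> l l' l''; symmetry; move: l; apply: linear_ext => [r u v|r u v|S].
- by rewrite !linearPl.
- by rewrite linearPl.
rewrite -/(v_ S); move: l'; apply: linear_ext => [r u v|r u v|T].
- by rewrite linearPr linearPl.
- by rewrite linearPl linearPr.
rewrite -/(v_ T); move: l''; apply: linear_ext => [r u v|r u v|U].
- by rewrite linearPr.
- by rewrite !linearPr.
exact: wedge_vA.
Qed.

(* The sign moves v_k to the right end of v_S. *)
Definition contr_basis k S : L :=
  if k \in S then (-1 : P) ^+ inversions S [set k] *: v_ (S :\ k) else 0.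

Definition contr k l : L := \sum_S (l S : P) *: contr_basis k S.

HB.instance Definition _ k := GRing.isLinear.Build P L L _ (contr k)
  (lincomb_linear _).

Lemma contr_v k S : contr k (v_ S) = contr_basis k S.
Proof.
rewrite -[RHS](sum_basis S (contr_basis k)).
by apply: eq_bigr => T _; rewrite v_E.
Qed.

Lemma contr_contr k l : contr k (contr k l) = 0.
Proof.
move: l; apply: linear_ext => [r u v|r u v|S]; first by rewrite !linearP.
  by rewrite scaler0 addr0.
rewrite -/(v_ S) contr_v /contr_basis.
case: (boolP (k \in S)) => kS; last by rewrite linear0.
by rewrite linearZ /= contr_v /contr_basis !inE eqxx scaler0.
Qed.

Lemma contrC j k l : contr j (contr k l) = - contr k (contr j l).
Proof.
have [->|jk] := eqVneq j k; first by rewrite contr_contr oppr0.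
move: l; apply: linear_ext => [r u v|r u v|S]; first by rewrite !linearP.
  by rewrite [contr j _]linearP [contr k _]linearP opprD scalerN.
rewrite -/(v_ S) !contr_v /contr_basis.
have kSj : (k \in S :\ j) = (k \in S) by rewrite !inE eq_sym jk.
have jSk : (j \in S :\ k) = (j \in S) by rewrite !inE jk.
case: (boolP (k \in S)) => kS; case: (boolP (j \in S)) => jS; last first.
- by rewrite [contr j _]linear0 [contr k _]linear0 oppr0.
- rewrite [contr j _]linear0 [contr k _]linearZ /= contr_v /contr_basis kSj (negPf kS).
  by rewrite scaler0 oppr0.
- rewrite [contr k _]linear0 [contr j _]linearZ /= contr_v /contr_basis jSk (negPf jS).
  by rewrite scaler0 oppr0.
rewrite [contr j _]linearZ [contr k _]linearZ /= !contr_v /contr_basis kSj jSk kS jS.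
rewrite !scalerA -!exprD -scaleNr -[- (_ ^+ _)]mulN1r -exprS setDDl setUC -setDDl.
congr (_ *: _); apply: eq_signr.
(* The two exponents differ only in the inversions between [j] and [k], of which there is exactly
   one. *)
rewrite (inversionsD1l _ jS) (inversionsD1l [set j] kS).
have /= := inversions1C [set k] j.
rewrite (_ : _ :\ j = [set k]) ?cards1; last first.
  by apply/setP => i; rewrite !inE; case: eqP => // ->; rewrite (negPf jk).
by move=> jk1; lia.
Qed.

(** Contraction acts from the right, so the left factor pays for moving $v_k$ past $v_T$. If [k] is
    in both sets, the left side is zero and the two terms cancel; if it is in one, a single term
    survives; if in neither, all vanish. *)
Lemma contr_wedge_v k S T : contr k (wedge (v_ S) (v_ T)) =
  wedge (v_ S) (contr k (v_ T))
  + (-1 : P) ^+ #|T| *: wedge (contr k (v_ S)) (v_ T) :> L.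
Proof.
rewrite wedge_vE !contr_v /contr_basis.
case: (boolP (k \in S)) => kS; case: (boolP (k \in T)) => kT.
- rewrite linearZr_LR linearZl_LR /= !wedge_vE /wedge_basis.
  have /negPf -> : ~~ [disjoint S & T] by apply/pred0Pn; exists k; rewrite /= kS kT.
  have -> : [disjoint S & T :\ k] = [disjoint S :\ k & T].
    rewrite -!setI_eq0; congr (_ == _); apply/setP => i; rewrite !inE.
    by case: (i \in S); rewrite ?andbF ?andbT.
  case: (boolP [disjoint S :\ k & T]) => _; last by rewrite 3!scaler0 addr0 linear0.
  have -> : S :|: T :\ k = S :\ k :|: T.
    by apply/setP => i; rewrite !inE; case: eqP => // ->; rewrite kS kT.
  rewrite linear0 !scalerA -!exprD -scalerDl.
  suff -> : (-1 : P) ^+ (inversions T [set k] + inversions S (T :\ k)) =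
    - (-1) ^+ (#|T| + inversions S [set k] + inversions (S :\ k) T)%N.
    by rewrite addNr scale0r.
  rewrite -[- (_ ^+ _)]mulN1r -exprS; apply: eq_signr.
  (* Here [x] is [inversions S T], split by extracting [k] from [T] and from [S], and [t] is
     [#|T :\ k|], one less than [#|T|]. *)
  have parity (x a b c d e t : nat) : (x = c + b -> x = e + d -> e + a = t ->
    odd (a + b) = odd (t.+1 + c + d).+1)%N by lia.
  rewrite (cardsD1 k T) kT.
  exact: parity (inversionsD1r S kT) (inversionsD1l T kS) (inversions1C T k).
- rewrite linear0r add0r linearZl_LR /= wedge_vE /wedge_basis.
  have -> : [disjoint S :\ k & T] = [disjoint S & T].
    rewrite -!setI_eq0; congr (_ == _); apply/setP => i; rewrite !inE.
    by case: eqP => // ->; rewrite (negPf kT) !andbF.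
  case: (boolP [disjoint S & T]) => dST; last by rewrite 2!scaler0 linear0.
  rewrite linearZ /= contr_v /contr_basis inE kS /= !scalerA -!exprD.
  have -> : (S :|: T) :\ k = S :\ k :|: T.
    by apply/setP => i; rewrite !inE; case: eqP => // ->; rewrite (negPf kT).
  congr (_ *: _); apply: eq_signr.
  (* Now [k] is not in [T], so [t] is [#|T|] itself. *)
  have parity (x a c d e t : nat) : (x = e + d -> e + a = t ->
    odd (x + (c + a)) = odd (t + c + d))%N by lia.
  rewrite (inversionsUl _ dST) (cardsD1 k T) (negPf kT).
  exact: parity (inversionsD1l T kS) (inversions1C T k).
- rewrite linear0l scaler0 addr0 linearZr_LR /= wedge_vE /wedge_basis.
  have -> : [disjoint S & T :\ k] = [disjoint S & T].
    rewrite -!setI_eq0; congr (_ == _); apply/setP => i; rewrite !inE.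
    by case: eqP => // ->; rewrite (negPf kS).
  case: (boolP [disjoint S & T]) => dST; last by rewrite scaler0 linear0.
  rewrite linearZ /= contr_v /contr_basis inE kT orbT !scalerA -!exprD.
  have -> : (S :|: T) :\ k = S :|: T :\ k.
    by apply/setP => i; rewrite !inE; case: eqP => // ->; rewrite (negPf kS).
  congr (_ *: _); apply: eq_signr.
  have parity (x a b c : nat) : (x = c + b -> odd (x + (c + a)) = odd (a + b))%N by lia.
  by rewrite (inversionsUl _ dST); exact: parity (inversionsD1r S kT).
rewrite linear0r linear0l scaler0 addr0 /wedge_basis.
case: (boolP [disjoint S & T]) => _; last by rewrite linear0.
by rewrite linearZ /= contr_v /contr_basis inE (negPf kS) (negPf kT) scaler0.
Qed.

Lemma contr_wedge k l T : contr k (wedge l (v_ T)) =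
  wedge l (contr k (v_ T)) + (-1 : P) ^+ #|T| *: wedge (contr k l) (v_ T).
Proof.
move: l; apply: linear_ext => [r u v|r u v|S].
- by rewrite linearPl linearP.
- rewrite [contr k (_ + _)]linearP /= !linearPl /= 2!scalerDr addrACA.
  by rewrite 2!scalerA (mulrC r).
exact: contr_wedge_v.
Qed.

(** [enum S] is a filtered sublist of the increasing enumeration of all indices. *)
Lemma enum_val_ltn S (i j : 'I_#|S|) :
  (enum_val i < enum_val j)%N = (i < j)%N.
Proof.
have homo_lt (i' j' : 'I_#|S|) : (i' < j')%N -> (enum_val i' < enum_val j')%N.
  move=> lt_ij; pose lt_ord := relpre (@nat_of_ord n) ltn.
  have lt_trans : transitive lt_ord by move=> ? ? ?; exact: ltn_trans.
  have : sorted lt_ord (enum S).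
    apply: sorted_filter => //; rewrite -enumT.
    by rewrite -sorted_map val_enum_ord iota_ltn_sorted.
  move/(sorted_ltn_nth lt_trans (enum_default i')) => /(_ i' j').
  rewrite !inE -!cardE !ltn_ord => /(_ isT isT lt_ij).
  by rewrite -!enum_val_nth.
case: (ltngtP i j) => [||/val_inj ->]; last by rewrite ltnn.
- exact: homo_lt.
by move=> /homo_lt ji; rewrite ltnNge ltnW.
Qed.

(** Matches the sign of [contr_basis] with the sign $(-1)^{i-j}$ of the differential; the successor
    accounts for the 0-based [j]. *)
Lemma inversions_enum_val S (j : 'I_#|S|) :
  inversions S [set enum_val j] = (#|S| - j.+1)%N.
Proof.
have sum_gt (i m : nat) : (\sum_(k < m) (i < k) = m - i.+1)%N.
  by elim: m => [|m IH]; rewrite ?big_ord0 // big_ord_recr /= IH; lia.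
rewrite inversionsE big_enum_val -(sum_gt j #|S|); apply: eq_bigr => i _.
by rewrite big_set1 enum_val_ltn.
Qed.

End ExteriorAlgebra.

(** * The differential through contractions, and the algebra laws *)

Section DifferentialAlgebra.
Variables (K : fieldType) (n p : nat) (h : 'I_p -> 'X_{1..n}).
Local Notation P := {mpoly K[n]}.
Local Notation W := (freeW K n p).
Local Notation L := (extV K n).
Local Notation C := (complexC K n p).
Implicit Types (w : W) (l : L) (T : {set 'I_n}) (k : 'I_n).

Fact tensor_is_bilinear :
  bilinear_for (GRing.Scale.Law.clone _ _ *:%R _) (GRing.Scale.Law.clone _ _ *:%R _)
    (@tensor K n p : W -> L -> C).
Proof.
split=> [l|w] r u v; apply/ffunP=> x; rewrite !ffunE /=.
  by rewrite mulrDl scalerAl.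
by rewrite mulrDr -[r *: _]/(r * _) mulrCA.
Qed.

HB.instance Definition _ := bilinear_isBilinear.Build P W L C _ _ (@tensor K n p)
  tensor_is_bilinear.
HB.instance Definition _ := bilinear_isBilinear.Build P C C C _ _ (@cprod K n p h)
  (bicomb_bilinear _).
HB.instance Definition _ := GRing.isLinear.Build P C C _ (@delta K n p h)
  (@delta_is_linear K n p h).

Lemma free_basis_tensor (x : 'I_p * {set 'I_n}) :
  free_basis P x = tensor (w_ x.1) (v_ x.2) :> C.
Proof. by apply/ffunP=> y; rewrite tensor_basis ffunE -surjective_pairing. Qed.

Lemma complexC_ext (M : lmodType P) (f g : C -> M) : linear f -> linear g ->
  (forall a T, f (tensor (w_ a) (v_ T)) = g (tensor (w_ a) (v_ T))) -> f =1 g.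
Proof.
move=> lin_f lin_g fg; apply: linear_ext => // -[a T].
by rewrite free_basis_tensor.
Qed.

Variable I : P -> Prop.
Hypotheses (idI : is_ideal I) (basis_h : is_pommaret_basis I h).

(** Frees the differential from ordered index tuples: on basis elements, indices outside [T]
    contract to zero and the others give the summands of [delta_basis]. *)
Lemma delta_tensorE w l :
  delta h (tensor w l) = \sum_k tensor (dvar h k w) (contr k l).
Proof.
move: w; apply: linear_ext => [r u v|r u v|a].
- by rewrite linearPl linearP.
- rewrite scaler_sumr -big_split; apply: eq_bigr => k _ /=.
  by rewrite [dvar _ _ _]linearP linearPl.
rewrite -/(w_ a); move: l; apply: linear_ext => [r u v|r u v|T].
- by rewrite linearPr linearP.
- rewrite scaler_sumr -big_split; apply: eq_bigr => k _ /=.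
  by rewrite [contr _ _]linearP linearPr.
rewrite -/(v_ T) delta_tensor (bigID (mem T)) /= [X in _ + X]big1 ?addr0; last first.
  by move=> k kT; rewrite contr_v /contr_basis (negPf kT) linear0r.
rewrite big_enum_val; apply: eq_bigr => j _ /=.
rewrite contr_v /contr_basis enum_valP inversions_enum_val linearZr_LR /=.
by rewrite (dvar_w idI basis_h).
Qed.

(** The diagonal condition is separate because antisymmetry does not imply it in characteristic
    2. *)
Lemma sum_alternating (V : zmodType) m (F : 'I_m -> 'I_m -> V) :
  (forall i, F i i = 0) -> (forall i j, F i j = - F j i) ->
  \sum_i \sum_j F i j = 0.
Proof.
move=> F0 FN.
(* [F] is its strictly upper triangular part minus the transpose of that part, and both have the
   same total. *)
have FE i j : F i j = (if (i < j)%N then F i j else 0)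
                      - (if (j < i)%N then F j i else 0).
  by case: ltngtP => [_|_|/val_inj ->]; rewrite ?subr0 ?sub0r.
under eq_bigr => i _ do under eq_bigr => j _ do rewrite FE.
under eq_bigr => i _ do rewrite sumrB.
by rewrite sumrB [X in _ - X]exchange_big subrr.
Qed.

(** The operators $A_k$ commute while contractions anticommute, so the double sum is alternating. *)
Lemma delta_delta (c : C) : delta h (delta h c) = 0.
Proof.
move: c; apply: complexC_ext => [r u v|r u v|a T]; first by rewrite !linearP.
  by rewrite scaler0 addr0.
rewrite delta_tensorE linear_sum /=.
under eq_bigr => k _ do rewrite delta_tensorE.
apply: sum_alternating => [k|k j]; first by rewrite contr_contr linear0r.
by rewrite (dvarC idI basis_h) contrC linearNr.
Qed.

(** [contr_wedge] yields two terms for each [k]; $A_k$ is moved onto whichever factor of the product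
    in $W$ accompanies the contracted form. *)
Lemma delta_cprod_tensor w w' l T :
  delta h (cprod h (tensor w l) (tensor w' (v_ T))) =
  cprod h (tensor w l) (delta h (tensor w' (v_ T)))
  + (-1 : P) ^+ #|T| *: cprod h (delta h (tensor w l)) (tensor w' (v_ T)).
Proof.
rewrite cprod_tensor !delta_tensorE linear_sumr linear_sumlz scaler_sumr -big_split.
apply: eq_bigr => k _ /=; rewrite !cprod_tensor contr_wedge.
rewrite linearDr linearZr_LR /= -(dvar_wprodr idI basis_h).
by rewrite -(dvar_wprodl idI basis_h).
Qed.

Lemma delta_cprod j (a b : C) : form_degree j b ->
  delta h (cprod h a b) =
  cprod h a (delta h b) + (-1 : P) ^+ j *: cprod h (delta h a) b.
Proof.
(* With [j] fixed both sides are linear in [b]; on each basis element in the support of [b], [bj]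
   turns [j] into the size of its index set. *)
move=> bj; apply: (linear_ext_supp (f := fun d => delta h (cprod h a d))
  (g := fun d => cprod h a (delta h d) + (-1 : P) ^+ j *: cprod h (delta h a) d))
  => [r u v|r u v|x /bj <-] /=.
- by rewrite linearPr linearP.
- rewrite [delta h (_ + _)]linearP /= !linearPr /= 2!scalerDr addrACA.
  by rewrite 2!scalerA (mulrC r).
rewrite free_basis_tensor; move: a; apply: complexC_ext => [r u v|r u v|a T].
- by rewrite linearPl linearP.
- rewrite [delta h (_ + _)]linearP /= !linearPl /= 2!scalerDr addrACA.
  by rewrite 2!scalerA (mulrC r).
exact: delta_cprod_tensor.
Qed.

Lemma cprodA : associative (@cprod K n p h).
Proof.
move=> a b c; move: a; apply: complexC_ext => [r u v|r u v|a S].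
- by rewrite linearPl.
- by rewrite !linearPl.
move: b; apply: complexC_ext => [r u v|r u v|b T].
- by rewrite linearPl linearPr.
- by rewrite linearPr linearPl.
move: c; apply: complexC_ext => [r u v|r u v|c U].
- by rewrite !linearPr.
- by rewrite linearPr.
by rewrite !cprod_tensor (wprodA idI basis_h) wedgeA.
Qed.

End DifferentialAlgebra.

Theorem theorem7p4 (K : fieldType) (n p : nat) (I : {mpoly K[n]} -> Prop)
    (h : 'I_p -> 'X_{1..n})
    (qsI : quasi_stable I) (basis_h : is_pommaret_basis I h) :
  [/\ (forall c : complexC K n p, delta h (delta h c) = 0),
      (forall a b c : complexC K n p,
         cprod h (cprod h a b) c = cprod h a (cprod h b c)) &
      (forall (i j : nat) (a b : complexC K n p),
         form_degree i a -> form_degree j b ->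
         delta h (cprod h a b)
         = cprod h a (delta h b)
           + (-1 : {mpoly K[n]}) ^+ j *: cprod h (delta h a) b)].
Proof.
have idI := qsI.1.1; split.
- exact: delta_delta idI basis_h.
- by move=> a b c; rewrite (cprodA idI basis_h).
by move=> i j a b _; exact: delta_cprod idI basis_h _ _ _.
Qed.
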